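(* Let $k$ be a field of characteristic $0$. The set $$S:=X\cup\{u^{*}\mid u\in B,\ \mathrm{wt}(u)=-2\}$$ is a basis of the vector space $ST\langle X\rangle$. Moreover, for every $n\ge 2$, $$\dim ST^{\mathrm{mult}}_n=\binom{2n-3}{n-1},$$ where $ST^{\mathrm{mult}}_n$ is the subspace of elements of $ST\langle X\rangle$ that are multilinear of degree $n$ in $x_1,\dots,x_n$.
   Context: A perm algebra is an associative algebra satisfying $(ab)c=(ba)c$. $\mathrm{DerPerm}\langle X\rangle$ is the free differential perm algebra on $X=\{x_1,x_2,\dots\}$ over $k$: the free perm algebra generated by the symbols $x^{(s)}$ ($x\in X$, $s\ge0$, $x^{(0)}=x$) with derivation $d$ (written $a'=d(a)$) determined by $d(x^{(s)})=x^{(s+1)}$ and the Leibniz rule. $B$ is its standard basis, consisting of the monomials $x_{k_1}^{(i_1)}\cdots x_{k_{n-1}}^{(i_{n-1})}x_{k_n}^{(i_n)}$ with $n\ge1$, $k_1\le\dots\le k_{n-1}$, $k_n$ arbitrary, $i_j\ge 0$ (the first $n-1$ factors commute; monomials are identified when equal as elements). The degree of such a monomial is $n$ and its weight is $\mathrm{wt}=\sum_{j=1}^n(i_j-1)$. A monomial is multilinear in $x_1,\dots,x_n$ if $\{k_1,\dots,k_n\}=\{1,\dots,n\}$, with arbitrary derivative orders. The linear operator $*$ on $\mathrm{DerPerm}\langle X\rangle$ is defined recursively by $(x^{(i)})^{*}=x^{(i+1)}$ and $(uv)^{*}=u\,v^{*}+v\,u^{*}$; $S$ is regarded as a set of elements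 (coinciding elements $u^*$ counted once). $ST\langle X\rangle$ is the smallest linear subspace of $\mathrm{DerPerm}\langle X\rangle$ containing $X$ and closed under the product $a\diamond b:=ab'+ba'$. *)

(* Defs.v *)
From HB Require Import structures.
From mathcomp Require Import all_boot all_order all_algebra.
From mathcomp Require Import finmap multiset monalg.

Set Implicit Arguments.
Unset Strict Implicit.
Unset Printing Implicit Defensive.

Import GRing.Theory.
Local Open Scope ring_scope.

Section Bases.
Variables (k : fieldType) (V : lmodType k).

Definition lin_indep (S : V -> Prop) : Prop :=
  forall (s : seq V) (c : V -> k),
    uniq s -> (forall v, v \in s -> S v) ->
    \sum_(v <- s) c v *: v = 0 -> forall v, v \in s -> c v = 0.

Definition in_span (S : V -> Prop) (w : V) : Prop :=
  exists (s : seq V) (c : V -> k),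
    (forall v, v \in s -> S v) /\ w = \sum_(v <- s) c v *: v.

(* [S] and [W] are subsets of [V]; [W] is meant to be a linear subspace. *)
Definition is_basis (S W : V -> Prop) : Prop :=
  [/\ forall v, S v -> W v, lin_indep S & forall w, W w -> in_span S w].

Definition has_dim (W : V -> Prop) (n : nat) : Prop :=
  exists s : seq V,
    [/\ uniq s, size s = n & is_basis (fun v => v \in s) W].

End Bases.

(* The pair [(i, s)] stands for the symbol x_{i+1}^{(s)}: the variables
   x_1, x_2, ... are numbered from 0. *)
Definition gen : choiceType := (nat * nat)%type.

Definition gen' (y : gen) : gen := (y.1, y.2.+1).

(* The standard basis of the free perm algebra on [gen]: the pair [(m, y)] is
   the monomial whose last factor is [y] and whose other factors, which
   commute, form the multiset [m]. *)
Definition mon : choiceType := ({mset gen}%mset * gen)%type.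

Definition letters (u : mon) : seq gen := rcons (enum_mset u.1) u.2.

Definition mdegree (u : mon) : nat := size (letters u).

Definition mweight (u : mon) : int := \sum_(y <- letters u) (y.2%:Z - 1).

Definition mon_mul (u v : mon) : mon := ((u.1 `+` (u.2 +` v.1))%mset, v.2).

Definition word (s : seq gen) (y : gen) : mon := (seq_mset s, y).

Definition multilinear_mon (n : nat) (u : mon) : Prop :=
  mdegree u = n /\ [seq y.1 | y <- letters u] =i iota 0 n.

Definition DerPerm (k : fieldType) : lmodType k := {malg k[mon]}.

(* Linear extension; locked, like [pmul], so that unification does not compute
   with it. *)
HB.lock Definition lext (k : fieldType) (V : lmodType k) (f : mon -> V)
    (a : DerPerm k) : V := \sum_(u <- msupp a) mcoeff u a *: f u.
Arguments lext {k V} f a.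

Definition monv (k : fieldType) (u : mon) : DerPerm k := << u >>.

HB.lock Definition pmul (k : fieldType) (a b : DerPerm k) : DerPerm k :=
  lext (fun u => lext (fun v => monv k (mon_mul u v)) b) a.
Arguments pmul {k} a b.

Section DerPermOps.
Variable k : fieldType.
Local Notation D := (DerPerm k).

Definition genv (y : gen) : D := monv k (mset0, y).

Definition xvar (i : nat) : D := genv (i, 0%N).

Local Notation "a ** b" := (pmul a b) (at level 40, left associativity).

(* [der_word s y] and [star_word s y] unfold the Leibniz rule and the recursion
   for [star] by splitting off the first factor of the word [rcons s y]; by
   [der_word_perm] and [star_word_perm] they do not depend on the order of [s],
   so that any enumeration of the multiset of commuting factors may be used. *)
Fixpoint der_word (s : seq gen) (y : gen) : D :=
  if s is z :: s' then
    genv (gen' z) ** monv k (word s' y) + genv z ** der_word s' y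
  else genv (gen' y).

Definition der : D -> D := lext (fun u => der_word (enum_mset u.1) u.2).

Fixpoint star_word (s : seq gen) (y : gen) : D :=
  if s is z :: s' then
    genv z ** star_word s' y + monv k (word s' y) ** genv (gen' z)
  else genv (gen' y).

Definition star : D -> D := lext (fun u => star_word (enum_mset u.1) u.2).

Definition diamond (a b : D) : D := a ** der b + b ** der a.

Inductive ST : D -> Prop :=
| ST_xvar i : ST (xvar i)
| ST_zero : ST 0
| ST_lin (c : k) a b : ST a -> ST b -> ST (c *: a + b)
| ST_diamond a b : ST a -> ST b -> ST (diamond a b).

Definition S_set (v : D) : Prop :=
  (exists i, v = xvar i) \/
  (exists u : mon, mweight u = -2 /\ v = star (monv k u)).

Definition STmult (n : nat) (a : D) : Prop :=
  ST a /\ forall u, u \in msupp a -> multilinear_mon n u.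

End DerPermOps.

Notation "a ** b" := (pmul a b) (at level 40, left associativity) : ring_scope.

(* The facts below show that [DerPerm k] is the free perm algebra on [gen],
   that [der] is the derivation extending [gen'] ([der_gen], [der_leibniz]), and
   that [star] satisfies its defining recursion for arbitrary factorisations
   ([star_gen], [star_mul]). *)
Section Validation.
Variable k : fieldType.
Local Notation D := (DerPerm k).

Lemma lextEw (V : lmodType k) (f : mon -> V) (d : {fset mon}) (a : D) :
  (msupp a `<=` d)%fset -> lext f a = \sum_(u <- d) mcoeff u a *: f u.
Proof.
move=> le; rewrite lext.unlock (big_fset_incl _ le) // => u _ /mcoeff_outdom ->.
by rewrite scale0r.
Qed.

Lemma lextP (V : lmodType k) (f : mon -> V) (c : k) (a b : D) :
  lext f (c *: a + b) = c *: lext f a + lext f b.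
Proof.
pose d := (msupp a `|` msupp b `|` msupp (c *: a + b))%fset.
rewrite !(@lextEw _ f d); try by rewrite /d; apply/fsubsetP => u; rewrite !inE => ->; rewrite ?orbT.
rewrite scaler_sumr -big_split /=; apply: eq_bigr => u _.
by rewrite mcoeffD mcoeffZ scalerDl scalerA.
Qed.

Lemma lext_mon (V : lmodType k) (f : mon -> V) u : lext f (monv k u) = f u.
Proof.
by rewrite lext.unlock /monv msuppU oner_eq0 big_seq_fset1 mcoeffUU scale1r.
Qed.

Lemma lext0 (V : lmodType k) (f : mon -> V) : lext f 0 = 0.
Proof. by rewrite lext.unlock msupp0 big_seq_fset0. Qed.

Lemma lextD (V : lmodType k) (f : mon -> V) a b :
  lext f (a + b) = lext f a + lext f b.
Proof. by have := lextP f 1 a b; rewrite !scale1r. Qed.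

Lemma lextZ (V : lmodType k) (f : mon -> V) c a :
  lext f (c *: a) = c *: lext f a.
Proof. by have := lextP f c a 0; rewrite lext0 !addr0. Qed.

Lemma DerPerm_ind (P : D -> Prop) :
  P 0 -> (forall c u a, P a -> P (c *: monv k u + a)) -> forall a, P a.
Proof.
move=> P0 PS a; rewrite (monalgE a).
elim/big_rec: _ => // u b _ /(PS (mcoeff u a) u).
suff -> : mcoeff u a *: monv k u = << mcoeff u a *g u >> by [].
apply/malgP => v; rewrite mcoeffZ /monv !mcoeffU.
by case: eqP => _; rewrite ?mulr1 ?mulr0.
Qed.

Lemma pmulPl (c : k) a b e : (c *: a + b) ** e = c *: (a ** e) + b ** e :> D.
Proof. by rewrite pmul.unlock lextP. Qed.

Lemma lextE (V : lmodType k) (f : mon -> V) (a : D) :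
  lext f a = \sum_(u <- msupp a) mcoeff u a *: f u.
Proof. by rewrite lext.unlock. Qed.

Lemma pmulE (a b : D) :
  a ** b = \sum_(u <- msupp a) mcoeff u a *: lext (fun v => monv k (mon_mul u v)) b.
Proof. by rewrite pmul.unlock lextE. Qed.

Lemma pmulPr (c : k) a b e : e ** (c *: a + b) = c *: (e ** a) + e ** b :> D.
Proof.
rewrite !pmulE scaler_sumr -big_split /=; apply: eq_bigr => u _.
by rewrite lextP scalerDr !scalerA mulrC.
Qed.

Lemma pmul0l e : 0 ** e = 0 :> D.
Proof. by rewrite pmul.unlock lext0. Qed.

Lemma pmul0r e : e ** 0 = 0 :> D.
Proof. by have := pmulPr (-1) 0 0 e; rewrite scaleN1r oppr0 addr0 scaleN1r addNr. Qed.

Lemma pmulDl a b e : (a + b) ** e = a ** e + b ** e :> D.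
Proof. by have := pmulPl 1 a b e; rewrite !scale1r. Qed.

Lemma pmulDr a b e : e ** (a + b) = e ** a + e ** b :> D.
Proof. by have := pmulPr 1 a b e; rewrite !scale1r. Qed.

Lemma pmul_mon u v : monv k u ** monv k v = monv k (mon_mul u v).
Proof. by rewrite pmul.unlock !lext_mon. Qed.

Lemma lin_congr (V : lmodType k) (c : k) (x x' y y' : V) :
  x = x' -> y = y' -> c *: x + y = c *: x' + y'.
Proof. by move=> -> ->. Qed.

Lemma mon_eq (m m' : {mset gen}%mset) (y : gen) :
  m = m' -> (m, y) = (m', y) :> mon.
Proof. by move->. Qed.

Lemma mon_mul_perm (u v w : mon) :
  mon_mul (mon_mul u v) w = mon_mul (mon_mul v u) w.
Proof.
case: u v w => [m y] [m' y'] [m'' y'']; apply: mon_eq => /=.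
rewrite !msetDA; congr (_ `+` _)%mset.
by rewrite -msetDA [LHS]msetDC msetDA.
Qed.

Lemma pmulA a b e : a ** (b ** e) = a ** b ** e :> D.
Proof.
elim/DerPerm_ind: a => [|c u a IH]; first by rewrite !pmul0l.
rewrite !pmulPl IH; apply: lin_congr; last by [].
elim/DerPerm_ind: b {IH a c} => [|c v a IH]; first by rewrite pmul0r !pmul0l pmul0r.
rewrite !(pmulPl, pmulPr) IH; apply: lin_congr; last by [].
elim/DerPerm_ind: e {IH a c} => [|c w a IH]; first by rewrite !pmul0r.
rewrite !pmulPr IH; apply: lin_congr; last by [].
by rewrite !pmul_mon /mon_mul /= !msetDA.
Qed.

Lemma pmul_perm a b e : a ** b ** e = b ** a ** e :> D.
Proof.
elim/DerPerm_ind: a => [|c u a IH]; first by rewrite pmul0r !pmul0l.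
rewrite !(pmulPl, pmulPr) IH; apply: lin_congr; last by [].
elim/DerPerm_ind: b {IH a c} => [|c v a IH]; first by rewrite pmul0r !pmul0l.
rewrite !(pmulPl, pmulPr) IH; apply: lin_congr; last by [].
elim/DerPerm_ind: e {IH a c} => [|c w a IH]; first by rewrite !pmul0r.
rewrite !pmulPr IH; apply: lin_congr; last by [].
by rewrite !pmul_mon mon_mul_perm.
Qed.

Lemma pmulCA a b e : a ** (b ** e) = b ** (a ** e) :> D.
Proof. by rewrite !pmulA (pmul_perm a). Qed.

Lemma word_cons z s y : monv k (word (z :: s) y) = genv k z ** monv k (word s y).
Proof. by rewrite pmul_mon /mon_mul /word /= mset0D mset_cons. Qed.

Lemma word_nil y : word [::] y = (mset0, y).
Proof. by apply: mon_eq; apply/msetP => z; rewrite mset_seqE mset0E. Qed.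

Lemma word_cat s y t z :
  monv k (word (s ++ y :: t) z) = monv k (word s y) ** monv k (word t z).
Proof.
elim: s => [|w s IH] /=; first by rewrite word_cons word_nil.
by rewrite !word_cons IH pmulA.
Qed.

Lemma word_mon (u : mon) : word (enum_mset u.1) u.2 = u.
Proof. by case: u => m y; rewrite /word seq_mset_id. Qed.

Lemma perm_mon_mul (u v : mon) :
  perm_eq (enum_mset (mon_mul u v).1) (enum_mset u.1 ++ u.2 :: enum_mset v.1).
Proof.
apply/allP => z _ /=; apply/eqP.
by rewrite count_cat /= !count_mem_mset !msetE2 msetnE eq_sym; case: eqP.
Qed.

Lemma der_word_swap s1 z s2 y :
  der_word k (s1 ++ z :: s2) y = der_word k (z :: s1 ++ s2) y.
Proof.
elim: s1 => [|w s1 IH]; first by [].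
rewrite 2!cat_cons /= IH.
have -> : word (s1 ++ z :: s2) y = word (z :: s1 ++ s2) y.
  by apply: mon_eq; apply/eq_seq_msetP; rewrite -cat1s perm_catCA.
rewrite !word_cons /= !pmulDr [LHS]addrCA.
by rewrite (pmulCA (genv k (gen' w))) (pmulCA (genv k w)) (pmulCA (genv k w) (genv k z)).
Qed.

Lemma der_word_perm s t y : perm_eq s t -> der_word k s y = der_word k t y.
Proof.
elim: s t => [|z s IH] t.
  by move=> /perm_size /esym /size0nil ->.
move=> st; have /splitPr zt : z \in t by rewrite -(perm_mem st) mem_head.
case: zt st => t1 t2 st; rewrite der_word_swap /=.
have st' : perm_eq s (t1 ++ t2).
  by move: st; rewrite perm_sym -cat1s perm_catCA /= perm_cons perm_sym.
by rewrite (IH _ st') (_ : word s y = word (t1 ++ t2) y) //; apply: mon_eq; apply/eq_seq_msetP.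
Qed.

Lemma der_word_cat s y t z :
  der_word k (s ++ y :: t) z =
  der_word k s y ** monv k (word t z) + monv k (word s y) ** der_word k t z.
Proof.
elim: s => [|w s IH] /=; first by rewrite word_nil.
by rewrite IH word_cat word_cons pmulDl !pmulDr !pmulA addrA.
Qed.

Lemma star_word_swap s1 z s2 y :
  star_word k (s1 ++ z :: s2) y = star_word k (z :: s1 ++ s2) y.
Proof.
elim: s1 => [|w s1 IH]; first by [].
rewrite 2!cat_cons /= IH.
have -> : word (s1 ++ z :: s2) y = word (z :: s1 ++ s2) y.
  by apply: mon_eq; apply/eq_seq_msetP; rewrite -cat1s perm_catCA.
rewrite !word_cons /= !pmulDr !pmulA (pmul_perm (genv k w) (genv k z)).
by rewrite addrAC.
Qed.

Lemma star_word_perm s t y : perm_eq s t -> star_word k s y = star_word k t y.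
Proof.
elim: s t => [|z s IH] t.
  by move=> /perm_size /esym /size0nil ->.
move=> st; have /splitPr zt : z \in t by rewrite -(perm_mem st) mem_head.
case: zt st => t1 t2 st; rewrite star_word_swap /=.
have st' : perm_eq s (t1 ++ t2).
  by move: st; rewrite perm_sym -cat1s perm_catCA /= perm_cons perm_sym.
by rewrite (IH _ st') (_ : word s y = word (t1 ++ t2) y) //; apply: mon_eq; apply/eq_seq_msetP.
Qed.

Lemma star_word_cat s y t z :
  star_word k (s ++ y :: t) z =
  monv k (word s y) ** star_word k t z + monv k (word t z) ** star_word k s y.
Proof.
elim: s => [|w s IH] /=; first by rewrite word_nil.
rewrite IH word_cat word_cons !pmulDr !pmulA.
rewrite (pmul_perm (monv k (word t z)) (genv k w)).
by rewrite (pmul_perm (monv k (word t z)) (monv k (word s y))) addrA.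
Qed.

Lemma derP (c : k) a b : der (c *: a + b) = c *: der a + der b.
Proof. exact: lextP. Qed.

Lemma starP (c : k) a b : star (c *: a + b) = c *: star a + star b.
Proof. exact: lextP. Qed.

Lemma der_gen y : der (genv k y) = genv k (gen' y).
Proof. by rewrite /der lext_mon /= enum_mset0. Qed.

Lemma star_gen y : star (genv k y) = genv k (gen' y).
Proof. by rewrite /star lext_mon /= enum_mset0. Qed.

Lemma der_leibniz a b : der (a ** b) = der a ** b + a ** der b :> D.
Proof.
elim/DerPerm_ind: a => [|c u a IH].
  by rewrite pmul0l /der lext0 !pmul0l addr0.
rewrite !(derP, pmulPl) {}IH [RHS]addrACA -scalerDr; apply: lin_congr; last by [].
elim/DerPerm_ind: b => [|e v b IH].
  by rewrite pmul0r /der lext0 !pmul0r addr0.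
rewrite !(derP, pmulPr) {}IH [RHS]addrACA -scalerDr; apply: lin_congr; last by [].
rewrite pmul_mon /der !lext_mon (der_word_perm _ (perm_mon_mul u v)).
by rewrite der_word_cat !word_mon.
Qed.

Lemma star_mul a b : star (a ** b) = a ** star b + b ** star a :> D.
Proof.
elim/DerPerm_ind: a => [|c u a IH].
  by rewrite pmul0l /star lext0 pmul0l pmul0r addr0.
rewrite !(starP, pmulPl, pmulPr) {}IH [RHS]addrACA -scalerDr; apply: lin_congr; last by [].
elim/DerPerm_ind: b => [|e v b IH].
  by rewrite pmul0r /star lext0 pmul0l pmul0r addr0.
rewrite !(starP, pmulPl, pmulPr) {}IH [RHS]addrACA -scalerDr; apply: lin_congr; last by [].
rewrite pmul_mon /star !lext_mon (star_word_perm _ (perm_mon_mul u v)).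
by rewrite star_word_cat !word_mon.
Qed.

Section Universal.
Variables (A : lmodType k) (mul : A -> A -> A).
Hypothesis mulPl : forall c a b e, mul (c *: a + b) e = c *: mul a e + mul b e.
Hypothesis mulPr : forall c a b e, mul e (c *: a + b) = c *: mul e a + mul e b.
Hypothesis mulA : forall a b e, mul a (mul b e) = mul (mul a b) e.
Hypothesis mul_perm : forall a b e, mul (mul a b) e = mul (mul b a) e.
Variable f : gen -> A.

Definition eval_word (s : seq gen) (y : gen) : A :=
  foldr (fun z => mul (f z)) (f y) s.

Definition eval : D -> A := lext (fun u => eval_word (enum_mset u.1) u.2).

Let mul0l e : mul 0 e = 0.
Proof. by have := mulPl (-1) 0 0 e; rewrite scaleN1r oppr0 addr0 scaleN1r addNr. Qed.

Let mul0r e : mul e 0 = 0.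
Proof. by have := mulPr (-1) 0 0 e; rewrite scaleN1r oppr0 addr0 scaleN1r addNr. Qed.

Lemma eval_word_perm s t y : perm_eq s t -> eval_word s y = eval_word t y.
Proof.
have swap s1 z s2 : eval_word (s1 ++ z :: s2) y = eval_word (z :: s1 ++ s2) y.
  by elim: s1 => //= w s1 ->; rewrite /= !mulA (mul_perm (f w)).
elim: s t => [|z s IH] t.
  by move=> /perm_size /esym /size0nil ->.
move=> st; have /splitPr zt : z \in t by rewrite -(perm_mem st) mem_head.
case: zt st => t1 t2 st; rewrite swap /= -(IH (t1 ++ t2)) //.
by move: st; rewrite perm_sym -cat1s perm_catCA /= perm_cons perm_sym.
Qed.

Lemma eval_linear (c : k) a b : eval (c *: a + b) = c *: eval a + eval b.
Proof. exact: lextP. Qed.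

Lemma eval_gen y : eval (genv k y) = f y.
Proof. by rewrite /eval lext_mon /= enum_mset0. Qed.

Lemma eval_mul a b : eval (a ** b) = mul (eval a) (eval b).
Proof.
elim/DerPerm_ind: a => [|c u a IH]; first by rewrite pmul0l /eval lext0 mul0l.
rewrite pmulPl !eval_linear mulPl {}IH; apply: lin_congr; last by [].
elim/DerPerm_ind: b => [|e v b IH]; first by rewrite pmul0r /eval lext0 mul0r.
rewrite pmulPr !eval_linear mulPr {}IH; apply: lin_congr; last by [].
rewrite pmul_mon /eval !lext_mon (eval_word_perm _ (perm_mon_mul u v)).
elim: (enum_mset u.1) => //= z s ->.
by rewrite mulA.
Qed.

Lemma eval_unique (g : D -> A) :
  (forall c a b, g (c *: a + b) = c *: g a + g b) ->
  (forall a b, g (a ** b) = mul (g a) (g b)) ->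
  (forall y, g (genv k y) = f y) -> g =1 eval.
Proof.
move=> gP gM gf.
have g0 : g 0 = 0 by have := gP (-1) 0 0; rewrite scaleN1r oppr0 addr0 scaleN1r addNr.
elim/DerPerm_ind => [|c u a IH]; first by rewrite g0 /eval lext0.
rewrite gP eval_linear IH; apply: lin_congr; last by [].
rewrite /eval lext_mon -{1}(word_mon u).
elim: (enum_mset u.1) => [|z s IHs] /=; first by rewrite word_nil gf.
by rewrite word_cons gM gf IHs.
Qed.

End Universal.

End Validation.

(* Main.v *)
(* The element [star u] depends only on the commutative image of [u]: for a
   commutative word [l] it is the sum over the letters [z] of [l] of [(l - z) z'].
   A term of this sum determines [l], which gives the linear independence.
   The operators [der] and [star] commute, hence agree on [ST], where therefore
   [diamond a b = star (a ** b)]; since [ST] has weight -1, it lies in the span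
   of [S].  Conversely, modulo [ST], the words of weight -2 and degree [n] are
   subject to [x d(u) = 0] and [d(u) d(v) = 0], for a variable [x] and words
   [u], [v] of weight -2 of smaller degree (by induction).  These relations
   force every such word to vanish as soon as 2 is invertible. *)
From mathcomp Require Import finmap multiset monalg zify.
Require Import Defs.
From mathcomp Require Import all_boot all_order all_algebra.
Set Implicit Arguments.
Unset Strict Implicit.
Unset Printing Implicit Defensive.
Import GRing.Theory.
Local Open Scope ring_scope.

(** * Commutative words as lists of letters, their derivatives and order sums *)

(** The summands of the Leibniz expansion of d(l), with repetition; [der_com_word] links them to
    [der]. *)
Fixpoint der_seq (l : seq gen) : seq (seq gen) :=
  if l is z :: l' then (gen' z :: l') :: map (cons z) (der_seq l') else [::].

(* A word [l] has weight -2 when [(osum l).+2 = size l]. *)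
Definition osum (l : seq gen) : nat := \sum_(y <- l) y.2.

Lemma osum_cons z l : osum (z :: l) = (z.2 + osum l)%N.
Proof. by rewrite /osum big_cons. Qed.

Lemma osum_pair x s l : osum ((x, s) :: l) = (s + osum l)%N.
Proof. exact: osum_cons. Qed.

Lemma size_gen_cons (z : gen) l : size (z :: l) = (size l).+1.
Proof. by []. Qed.

Definition shapeE := (osum_pair, osum_cons, size_gen_cons).

Lemma perm_shape (l l' : seq gen) : perm_eq l l' -> size l = size l' /\ osum l = osum l'.
Proof. by move=> ll'; split; [apply: perm_size | apply: perm_big]. Qed.

Lemma mem_der_seq l t : t \in der_seq l -> size t = size l /\ osum t = (osum l).+1.
Proof.
elim: l t => [|z l IH] t //=; rewrite inE => /predU1P[->|].
  by rewrite !osum_cons.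
by case/mapP => t' /IH [st ot] ->; rewrite /= st !osum_cons ot addnS.
Qed.

(** Pigeonhole: every letter of positive order contributes at least one to [osum]. *)
Lemma ltn_osum_zero l : (osum l < size l)%N -> exists x, (x, 0%N) \in l.
Proof.
elim: l => [|[x [|s]] l IH] /=; first by rewrite ltn0.
  by exists x; rewrite mem_head.
rewrite osum_cons addSn ltnS => /(leq_ltn_trans (leq_addl _ _)) /IH [y yl].
by exists y; rewrite inE yl orbT.
Qed.

Lemma osum_le_size l : ~~ has (fun z : gen => 1 < z.2)%N l -> (osum l <= size l)%N.
Proof.
elim: l => [|z l IH]; first by rewrite /osum big_nil.
rewrite shapeE /= negb_or -leqNgt => /andP[z_le1 /IH le_l].
by rewrite -add1n leq_add.
Qed.

Ltac perm_cons_tac := apply/permP => ?; rewrite /= ?count_cat /=; lia.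

(** * Reduction of words of weight -2 modulo a subgroup *)

Section Reduction.
(** [W] stands for [ST] and [K l] for the star of the commutative word [l]. [W_der1] and [W_der2]
    are the relations x d(l) = 0 and d(l) d(l') = 0 modulo [W]; [W_half] is division by 2. *)
Variables (V : zmodType) (W : V -> Prop) (K : seq gen -> V).
Hypothesis W0 : W 0.
Hypothesis WB : forall a b, W a -> W b -> W (a - b).
Hypothesis W_half : forall a, W (a + a) -> W a.
Hypothesis K_perm : forall l l', perm_eq l l' -> K l = K l'.
Hypothesis W_pair : forall x y, W (K [:: (x, 0%N); (y, 0%N)]).
Hypothesis W_der1 : forall x l, (0 < size l)%N -> W (K l) ->
  W (\sum_(t <- der_seq l) K ((x, 0%N) :: t)).
Hypothesis W_der2 : forall l l', (0 < size l)%N -> (0 < size l')%N -> W (K l) -> W (K l') ->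
  W (\sum_(t <- der_seq l) \sum_(t' <- der_seq l') K (t ++ t')).

Let WN a : W a -> W (- a).
Proof. by rewrite -[- a]sub0r; apply: WB. Qed.

Let WD a b : W a -> W b -> W (a + b).
Proof. by move=> Wa Wb; rewrite -[b]opprK; apply/WB/WN. Qed.

Let W_addl a b : W a -> W (a + b) -> W b.
Proof. by move=> Wa Wab; rewrite -(addKr a b) addrC; apply: WB. Qed.

Let W_addr a b : W b -> W (a + b) -> W a.
Proof. by rewrite addrC; apply: W_addl. Qed.

Let W_diff a b c : W (a + c) -> W (b + c) -> W (a - b).
Proof. by move=> Wa Wb; have := WB Wa Wb; rewrite opprD addrACA subrr addr0. Qed.

Let W_eqv a b c : W (a - b) -> W (a + c) -> W (b + c).
Proof. by move=> Wab Wac; have := WB Wac Wab; rewrite opprB addrC addrA subrK. Qed.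

Let W_sum (I : eqType) (r : seq I) (F : I -> V) :
  (forall i, i \in r -> W (F i)) -> W (\sum_(i <- r) F i).
Proof.
by move=> WF; rewrite big_seq; elim/big_rec: _ => // i a ir Wa; apply: WD => //; apply: WF.
Qed.

(** The value of [K] on p d(l), where the prefix [p] is not differentiated. *)
Let KD p l : V := \sum_(t <- der_seq l) K (p ++ t).

Let KD_cons p z l : KD p (z :: l) = K (gen' z :: p ++ l) + KD (z :: p) l.
Proof.
rewrite /KD /= big_cons big_map; congr (_ + _); first by apply: K_perm; perm_cons_tac.
by apply: eq_bigr => t _; apply: K_perm; perm_cons_tac.
Qed.

Let KD_perm p q l : perm_eq p q -> KD p l = KD q l.
Proof. by move=> pq; apply: eq_bigr => t _; apply: K_perm; rewrite perm_cat2r. Qed.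

Section Step.
Variable n : nat.
Hypothesis IH : forall l, (1 < size l < n)%N -> (osum l).+2 = size l -> W (K l).

Let rel1 (x : nat) l : (1 < size l < n)%N -> (osum l).+2 = size l -> W (KD [:: (x, 0%N)] l).
Proof. by move=> sl ol; apply: W_der1; [lia | apply: IH]. Qed.

(** The relations x d(y l) and y d(x l) share the part x y d(l), which cancels in their difference.
    Modulo [W] a derivative can thus be moved between letters of orders zero and one. *)
Let swap (x y : nat) l : (size l).+2 = n -> (osum l).+1 = size l ->
  W (K [:: (x, 0), (y, 1) & l]%N - K [:: (x, 1), (y, 0) & l]%N).
Proof.
move=> sl ol.
have Rx : W (KD [:: (x, 0%N)] ((y, 0%N) :: l)) by apply: rel1; rewrite ?shapeE; lia.
have Ry : W (KD [:: (y, 0%N)] ((x, 0%N) :: l)) by apply: rel1; rewrite ?shapeE; lia.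
move: Rx Ry; rewrite !KD_cons /gen' /=
  (@KD_perm [:: (x, 0); (y, 0)]%N [:: (y, 0); (x, 0)]%N); last by perm_cons_tac.
rewrite (K_perm (_ : perm_eq _ [:: (x, 0), (y, 1) & l]%N)); last by perm_cons_tac.
exact: W_diff.
Qed.

(* [d(xy) d(zh)] is congruent to [2 x (y' z' h + y z' h')] by [swap], and
   [x d(y z' h)] is congruent to [0]. *)
Let kill2 (x y z : nat) l : (size l).+3 = n -> (osum l).+1 = size l ->
  W (K [:: (x, 0), (y, 0), (z, 2) & l]%N).
Proof.
move=> sl ol; have l_gt0 : (0 < size l)%N by rewrite -ol.
have R1 : W (KD [:: (x, 0%N)] [:: (y, 0%N), (z, 1%N) & l]).
  by apply: rel1; rewrite ?shapeE; lia.
have Wzl : W (K ((z, 0%N) :: l)) by apply: IH; rewrite ?shapeE; lia.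
have R2 := W_der2 (isT : (0 < size [:: (x, 0%N); (y, 0%N)])%N)
   (isT : (0 < size ((z, 0%N) :: l))%N) (W_pair x y) Wzl.
move: R2; rewrite /= !big_cons big_nil addr0 /gen' /= !big_map /=.
(* The terms of d(xy) d(z l): [A] is x'y z'l, [B] is x'y z d(l), [C] is x y'z'l, [D] is x y'z d(l).
   By [swap], [A] is congruent to [C], while [B] and [D] are both congruent to E = x y z'd(l). *)
set A := K _; set B := \sum_(_ <- _) _; set C := K _; set D := \sum_(_ <- _) _ => R2.
have AC : W (A - C).
  have -> : A = K [:: (y, 0), (x, 1), (z, 1) & l]%N by apply: K_perm; perm_cons_tac.
  have -> : C = K [:: (y, 1), (x, 0), (z, 1) & l]%N by apply: K_perm; perm_cons_tac.
  by apply: swap; rewrite ?shapeE; lia.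
have BE : W (B - KD [:: (x, 0); (y, 0); (z, 1)]%N l).
  rewrite -sumrB; apply: W_sum => t /mem_der_seq [st ot].
  have -> : K [:: (x, 1), (y, 0), (z, 0) & t]%N = K [:: (z, 0), (x, 1), (y, 0) & t]%N.
    by apply: K_perm; perm_cons_tac.
  have -> : K ([:: (x, 0); (y, 0); (z, 1)]%N ++ t) = K [:: (z, 1), (x, 0), (y, 0) & t]%N.
    by apply: K_perm; perm_cons_tac.
  by apply: swap; rewrite ?shapeE ?st ?ot; lia.
have DE : W (D - KD [:: (x, 0); (y, 0); (z, 1)]%N l).
  rewrite -sumrB; apply: W_sum => t /mem_der_seq [st ot].
  have -> : K [:: (x, 0), (y, 1), (z, 0) & t]%N = K [:: (z, 0), (y, 1), (x, 0) & t]%N.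
    by apply: K_perm; perm_cons_tac.
  have -> : K ([:: (x, 0); (y, 0); (z, 1)]%N ++ t) = K [:: (z, 1), (y, 0), (x, 0) & t]%N.
    by apply: K_perm; perm_cons_tac.
  by apply: swap; rewrite ?shapeE ?st ?ot; lia.
move: R1; rewrite !KD_cons /gen' /=.
rewrite (@KD_perm _ [:: (x, 0); (y, 0); (z, 1)]%N); last by perm_cons_tac.
rewrite (K_perm (_ : perm_eq _ [:: (x, 0), (y, 1), (z, 1) & l]%N)); last by perm_cons_tac.
rewrite -/C addrCA; set E := KD _ _ in BE DE *.
(* Twice C + E is congruent to A + B + C + D, which lies in [W] by [R2]. The target is then what
   remains of x d(y z'l) after removing C + E. *)
have WCE : W (C + E).
  apply: W_half; rewrite -[C + E + _]addrA; apply: (W_eqv AC).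
  rewrite [A + _]addrCA; apply: (W_eqv BE).
  rewrite [C + E]addrC [B + _]addrCA [B + _]addrCA [A + _]addrCA.
  by apply: (W_eqv DE); move: R2; rewrite -addrA [C + D]addrC [B + _]addrCA [A + _]addrCA.
move=> R1'.
rewrite (K_perm (_ : perm_eq _ [:: (z, 2), (y, 0), (x, 0) & l]%N)); last by perm_cons_tac.
exact: W_addr WCE R1'.
Qed.

(* By induction on [s]: expand [x d(y z^(s-1) h)] and write [h = t h0] with [t] of order zero. *)
Let kill_high (x y z s : nat) l : (size l).+3 = n -> (1 < s)%N -> (osum l + s).-1 = size l ->
  W (K [:: (x, 0), (y, 0), (z, s) & l]%N).
Proof.
elim: s => [|[|s] IHs] // in x y l * => sl _; rewrite addnS succnK => ol.
case: s => [|s] in IHs ol *; first by apply: kill2; lia.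
have [|t /perm_to_rem] := @ltn_osum_zero l; first by lia.
move: (rem _ _) => h lh; have [] := perm_shape lh.
rewrite !shapeE => sh oh.
have : W (KD [:: (x, 0%N)] [:: (y, 0%N), (z, s.+2) & l]).
  by apply: rel1; rewrite ?shapeE; lia.
rewrite !KD_cons /gen' /= => R.
rewrite (K_perm (_ : perm_eq _ [:: (z, s.+3), (y, 0%N), (x, 0%N) & l])); last by perm_cons_tac.
apply: W_addr (W_addl _ R).
  apply: W_sum => u /mem_der_seq [su ou] /=.
  rewrite (K_perm (_ : perm_eq _ [:: (x, 0%N), (y, 0%N), (z, s.+2) & u])); last by perm_cons_tac.
  by apply: IHs; rewrite ?su ?ou; lia.
(* In the term x y'z^(s+2) l the letter y no longer has order zero; [t], taken from [l], replaces it
   so that the induction hypothesis applies. *)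
rewrite (K_perm (_ : perm_eq _ [:: (x, 0%N), (t, 0%N), (z, s.+2), (y, 1%N) & h])); last first.
  by apply/permP => a; rewrite /= (permP lh) /=; lia.
by apply: IHs; rewrite ?shapeE; lia.
Qed.

Lemma reduction_step l : (1 < size l)%N -> size l = n -> (osum l).+2 = size l -> W (K l).
Proof.
move=> l_gt1 sl ol.
have [|x /perm_to_rem] := @ltn_osum_zero l; first by lia.
move: (rem _ _) => l1 ll1; have [] := perm_shape ll1.
rewrite !shapeE => sl1 ol1.
have [|y /perm_to_rem] := @ltn_osum_zero l1; first by lia.
move: (rem _ _) => l2 ll2; have [] := perm_shape ll2.
rewrite !shapeE => sl2 ol2.
have ll : perm_eq l [:: (x, 0%N), (y, 0%N) & l2] by rewrite (permPl ll1) perm_cons.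
rewrite (K_perm ll).
(* Two letters of order zero have been split off, so [l2] has order sum equal to its length: either
   some letter has order above one, or all have order exactly one. *)
case: (boolP (has (fun z : gen => 1 < z.2)%N l2)) => [/hasP[[z s] /perm_to_rem]|].
  move: (rem _ _) => h lh /= s_gt1; have [] := perm_shape lh.
  rewrite !shapeE => sh oh.
  rewrite (K_perm (_ : perm_eq _ [:: (x, 0%N), (y, 0%N), (z, s) & h])); last by rewrite !perm_cons.
  by apply: kill_high; lia.
case: l2 => [|[z s] h] in ll2 sl2 ol2 ll *; first by move=> _; apply: W_pair.
rewrite /= negb_or -leqNgt => /andP[s_le1 /osum_le_size oh].
move: sl2 ol2; rewrite !shapeE => sl2 ol2; have s1 : s = 1%N by lia.
rewrite {s}s1 in s_le1 ol2 ll2 ll *.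
(* The derivative is removed from z, and x d(y z h) = x y'z h + x y z'h + x y z d(h) is used. The
   first two terms are congruent by [swap], and the last lies in [W], so twice the target does. *)
have R : W (KD [:: (x, 0%N)] [:: (y, 0%N), (z, 0%N) & h]).
  by apply: rel1; rewrite ?shapeE; lia.
have S : W (K [:: (z, 0), (y, 1), (x, 0) & h]%N - K [:: (z, 1), (y, 0), (x, 0) & h]%N).
  by apply: swap; rewrite ?shapeE; lia.
(* A term of d(h) has order sum one more than its length, hence a letter of order at least two, and
   [kill_high] applies. *)
have R' : W (KD [:: (z, 0%N); (y, 0%N); (x, 0%N)] h).
  apply: W_sum => u /mem_der_seq [su ou].
  case: (boolP (has (fun z : gen => 1 < z.2)%N u)) => [/hasP[[t s] /perm_to_rem]|/osum_le_size].
    move: (rem _ _) => h' lh /= s_gt1; have [] := perm_shape lh.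
    rewrite su ou !shapeE => sh' oh'.
    rewrite (K_perm (_ : perm_eq _ [:: (x, 0%N), (y, 0%N), (t, s), (z, 0%N) & h'])); last first.
      by apply/permP => a; rewrite /= (permP lh) /=; lia.
    by apply: kill_high; rewrite ?shapeE; lia.
  by rewrite ou su; lia.
move: R; rewrite !KD_cons /gen' /= addrA => /(W_addr R').
rewrite (K_perm (_ : perm_eq _ [:: (z, 0), (y, 1), (x, 0) & h]%N)); last by perm_cons_tac.
rewrite (K_perm (_ : perm_eq [:: (x, 0), (y, 0), (z, 1) & h]%N [:: (z, 1), (y, 0), (x, 0) & h]%N)).
  by move/(W_eqv S)/W_half.
by perm_cons_tac.
Qed.

End Step.

Lemma reduction l : (1 < size l)%N -> (osum l).+2 = size l -> W (K l).
Proof.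
have [n] := ubnP (size l); elim: n l => // n IHn l le_l l_gt1 ol.
apply: (@reduction_step (size l)) => // t /andP[t_gt1 t_lt] ot.
by apply: IHn => //; apply: leq_trans t_lt _.
Qed.

End Reduction.

(** * The operators [der] and [star], and their agreement on [ST] *)

Lemma perm_rem_cons (T : eqType) (x y : T) (s : seq T) :
  x \in s -> perm_eq (rem x (y :: s)) (y :: rem x s).
Proof. by move=> xs; rewrite /=; case: eqP => // ->; apply: perm_to_rem. Qed.

Section Algebra.
Variable k : fieldType.
Local Notation D := (DerPerm k).
Implicit Types a b c : D.

Lemma derD a b : der (a + b) = der a + der b.
Proof. exact: lextD. Qed.

Lemma starD a b : star (a + b) = star a + star b.
Proof. exact: lextD. Qed.

Lemma der0 : der 0 = 0 :> D.
Proof. exact: lext0. Qed.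

Lemma star0 : star 0 = 0 :> D.
Proof. exact: lext0. Qed.

Lemma DerPerm_word_ind (P : D -> Prop) :
  P 0 -> (forall e a b, P a -> P b -> P (e *: a + b)) ->
  (forall y, P (genv k y)) -> (forall y a, P a -> P (genv k y ** a)) ->
  forall a, P a.
Proof.
move=> P0 Plin Pgen Pmul; elim/DerPerm_ind => // e u a Pa; apply: Plin => //.
rewrite -(word_mon u); elim: (enum_mset u.1) => [|z s IHs]; first by rewrite word_nil; apply: Pgen.
by rewrite word_cons; apply: Pmul.
Qed.

(** On a product y a with a letter y, both sides expand into the same four terms, by the Leibniz
    rule and the recursion for [star]. *)
Lemma der_star a : der (star a) = star (der a).
Proof.
elim/DerPerm_word_ind: a => [|e a b IHa IHb|y|y a IH].
- by rewrite star0 der0 star0.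
- by rewrite starP !derP starP IHa IHb.
- by rewrite star_gen !der_gen star_gen.
- rewrite star_mul derD !der_leibniz starD !star_mul !star_gen !der_gen star_gen IH.
  by rewrite -!addrA; congr (_ + _); rewrite addrA addrC.
Qed.

(* [a] and [b] have the same image in the free commutative algebra. *)
Definition com_equiv a b : Prop := (forall c, a ** c = b ** c) /\ star a = star b.

Lemma com_equiv_refl a : com_equiv a a.
Proof. by []. Qed.

Lemma com_equivC a b : com_equiv (a ** b) (b ** a).
Proof. by split=> [c|]; [rewrite pmul_perm | rewrite !star_mul addrC]. Qed.

Lemma com_equivM a a' b b' : com_equiv a a' -> com_equiv b b' -> com_equiv (a ** b) (a' ** b').
Proof.
move=> [aM aS] [bM bS]; split; last by rewrite !star_mul aM bM aS bS.
by move=> c; rewrite -!pmulA aM bM.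
Qed.

Lemma com_equivP e a a' b b' : com_equiv a a' -> com_equiv b b' ->
  com_equiv (e *: a + b) (e *: a' + b').
Proof.
move=> [aM aS] [bM bS]; split; last by rewrite !starP aS bS.
by move=> c; rewrite !pmulPl aM bM.
Qed.

Lemma com_equivD a a' b b' : com_equiv a a' -> com_equiv b b' -> com_equiv (a + b) (a' + b').
Proof. by move=> aa' bb'; have := com_equivP 1 aa' bb'; rewrite !scale1r. Qed.

(** Modulo commutativity, the recursion for [star] becomes the Leibniz rule. *)
Lemma com_equiv_star_der a : com_equiv (star a) (der a).
Proof.
elim/DerPerm_word_ind: a => [|e a b IHa IHb|y|y a IH].
- by rewrite star0 der0.
- by rewrite starP derP; apply: com_equivP.
- by rewrite star_gen der_gen.
- rewrite star_mul star_gen der_leibniz der_gen addrC.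
  by apply: com_equivD; [apply: com_equivC | apply: com_equivM].
Qed.

(** If b and c satisfy the claim, their diamond product is star(bc). Then d(star(bc)) = star(d(bc))
    = star(star(bc)), because [star] only sees the commutative image of its argument. *)
Lemma der_ST a : ST a -> der a = star a.
Proof.
elim=> [i||e b c _ IHb _ IHc|b c _ IHb _ IHc].
- by rewrite der_gen star_gen.
- by rewrite der0 star0.
- by rewrite derP starP IHb IHc.
- by rewrite /diamond IHb IHc -star_mul der_star (com_equiv_star_der _).2.
Qed.

Lemma diamond_ST a b : ST a -> ST b -> diamond a b = star (a ** b).
Proof. by move=> /der_ST Da /der_ST Db; rewrite /diamond Da Db star_mul. Qed.

Lemma ST_star_mul a b : ST a -> ST b -> ST (star (a ** b)).
Proof. by move=> Sa Sb; rewrite -diamond_ST //; apply: ST_diamond. Qed.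

(** * The star of a commutative word, and its membership in [ST] *)

(** Closed form of the star of any monomial with letters [l]: each letter in turn is moved to the
    end and differentiated. *)
Definition star_seq (l : seq gen) : D := \sum_(z <- l) monv k (seq_mset (rem z l), gen' z).

Lemma star_seq_perm l l' : perm_eq l l' -> star_seq l = star_seq l'.
Proof.
move=> ll'; rewrite /star_seq (perm_big _ ll') /=; apply: eq_bigr => z _.
congr monv; apply: mon_eq; apply/eq_seq_msetP/allP => x _ /=.
by rewrite !count_rem (perm_mem ll') (permP ll').
Qed.

Lemma pmul_sumr (I : Type) (r : seq I) (P : pred I) (F : I -> D) a :
  a ** (\sum_(i <- r | P i) F i) = \sum_(i <- r | P i) a ** F i.
Proof. exact: (big_morph _ (fun b c => pmulDr b c a) (pmul0r a)). Qed.

Lemma pmul_suml (I : Type) (r : seq I) (P : pred I) (F : I -> D) a :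
  (\sum_(i <- r | P i) F i) ** a = \sum_(i <- r | P i) F i ** a.
Proof. exact: (big_morph (fun b => b ** a) (fun b c => pmulDl b c a) (pmul0l a)). Qed.

(* Used instead of [congr], which makes unification compute in [DerPerm k]. *)
Lemma addr_congr (a a' b b' : D) : a = a' -> b = b' -> a + b = a' + b'.
Proof. by move=> -> ->. Qed.

Lemma star_word_seq s y : star_word k s y = star_seq (y :: s).
Proof.
elim: s => [|z s IHs] /=.
  by rewrite /star_seq big_seq1 /= eqxx; congr monv; rewrite -word_nil.
rewrite (@star_seq_perm _ [:: z, y & s]); last by perm_cons_tac.
rewrite IHs {1}/star_seq pmul_sumr pmul_mon [in RHS]/star_seq [in RHS]big_cons addrC.
apply: addr_congr.
  rewrite /= eqxx /mon_mul /=; congr monv; apply: mon_eq.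
  by rewrite mset_cons; apply/msetP => x; rewrite !msetE2 mset0E addn0 addnC.
apply: eq_big_seq => w wl; rewrite pmul_mon; congr monv.
apply: mon_eq; rewrite mset0D -mset_cons; apply/eq_seq_msetP.
by rewrite perm_sym perm_rem_cons.
Qed.

Lemma star_monv u : star (monv k u) = star_seq (letters u).
Proof.
rewrite /star lext_mon star_word_seq; apply: star_seq_perm.
by rewrite /letters perm_sym perm_rcons.
Qed.

Lemma star_sum (I : Type) (r : seq I) (P : pred I) (F : I -> D) :
  star (\sum_(i <- r | P i) F i) = \sum_(i <- r | P i) star (F i).
Proof. exact: (big_morph _ starD star0). Qed.

(** A representative monomial with letters [l]; its last factor is an arbitrary choice, invisible to
    [star]. The value at the empty word is a default. *)
Definition com_word (l : seq gen) : D := if l is z :: s then monv k (word s z) else 0.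

Lemma star_com_word l : (0 < size l)%N -> star (com_word l) = star_seq l.
Proof.
case: l => // z s _ /=; rewrite star_monv; apply: star_seq_perm.
rewrite /letters /= perm_rcons perm_cons; apply/eq_seq_msetP.
exact: seq_mset_id.
Qed.

Lemma star_com_word_mul l l' : (0 < size l)%N -> (0 < size l')%N ->
  star (com_word l ** com_word l') = star_seq (l ++ l').
Proof.
case: l l' => // z s [|y t] // _ _; rewrite /= -word_cat star_monv; apply: star_seq_perm.
rewrite /letters /= perm_rcons.
have st : perm_eq (enum_mset (seq_mset (s ++ z :: t))) (s ++ z :: t).
  by apply/eq_seq_msetP; apply: seq_mset_id.
by apply/permP => a; rewrite /= (permP st) !count_cat /=; lia.
Qed.

Lemma der_com_word l : (0 < size l)%N -> der (com_word l) = \sum_(t <- der_seq l) com_word t.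
Proof.
case: l => // y s _ /=; rewrite /der lext_mon (der_word_perm _ (t := s)); last first.
  by apply/eq_seq_msetP; apply: seq_mset_id.
elim: s => [|z s IHs] /=; first by rewrite big_seq1 /= word_nil.
rewrite IHs !big_cons pmulDr addrCA; apply: addr_congr; first by rewrite /= word_cons.
apply: addr_congr; first by rewrite /= word_cons.
by rewrite pmul_sumr !big_map; apply: eq_bigr => t _; rewrite /= word_cons.
Qed.

Lemma xvar_com_word x : xvar k x = com_word [:: (x, 0%N)].
Proof. by rewrite /= word_nil. Qed.

(** The sum is the diamond product of x and star(l): in star(x star(l)) the inner star may be
    replaced by d(l), which has the same commutative image. *)
Lemma ST_der1 x l : (0 < size l)%N -> ST (star_seq l) ->
  ST (\sum_(t <- der_seq l) star_seq ((x, 0%N) :: t)).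
Proof.
move=> l_gt0 Sl; have := ST_star_mul (ST_xvar k x) Sl.
rewrite -(star_com_word l_gt0).
have -> : star (xvar k x ** star (com_word l)) = star (xvar k x ** der (com_word l)).
  by apply: (com_equivM (com_equiv_refl _) (com_equiv_star_der _)).2.
rewrite der_com_word // pmul_sumr star_sum big_seq [X in _ -> ST X]big_seq.
rewrite (eq_bigr (fun t => star_seq ((x, 0%N) :: t))) // => t /mem_der_seq [st _].
by rewrite xvar_com_word star_com_word_mul ?st.
Qed.

Lemma ST_der2 l l' : (0 < size l)%N -> (0 < size l')%N ->
  ST (star_seq l) -> ST (star_seq l') ->
  ST (\sum_(t <- der_seq l) \sum_(t' <- der_seq l') star_seq (t ++ t')).
Proof.
move=> l_gt0 l'_gt0 Sl Sl'; have := ST_star_mul Sl Sl'.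
rewrite -(star_com_word l_gt0) -(star_com_word l'_gt0).
have [_ ->] := com_equivM (com_equiv_star_der (com_word l)) (com_equiv_star_der (com_word l')).
rewrite !der_com_word // pmul_suml star_sum big_seq [X in _ -> ST X]big_seq.
rewrite (eq_bigr (fun t => \sum_(t' <- der_seq l') star_seq (t ++ t'))) // => t /mem_der_seq [st _].
rewrite pmul_sumr star_sum; apply: eq_big_seq => t' /mem_der_seq [st' _].
by rewrite star_com_word_mul ?st ?st'.
Qed.

Lemma ST_star_seq l : (2%:R != 0 :> k) -> (1 < size l)%N -> (osum l).+2 = size l -> ST (star_seq l).
Proof.
move=> two_neq0; apply: reduction.
- exact: ST_zero.
- by move=> a b Sa Sb; rewrite addrC -scaleN1r; apply: ST_lin.
(* Halving: a + a in [ST] is scaled by the inverse of 2. *)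
- move=> a Sa; rewrite -[a]addr0 -(scale1r a) -(mulVf two_neq0) -scalerA.
  by rewrite scaler_nat; apply: ST_lin Sa (ST_zero _).
- exact: star_seq_perm.
- move=> x y; rewrite -(@star_com_word_mul [:: (x, 0%N)] [:: (y, 0%N)]) //= !word_nil.
  exact: ST_star_mul (ST_xvar k x) (ST_xvar k y).
- exact: ST_der1.
- exact: ST_der2.
Qed.
End Algebra.

(** * Closure properties of linear spans *)

Section Span.
Variables (k : fieldType) (V : lmodType k).
Implicit Types (S : V -> Prop).

(** In [in_span] the coefficient is a function of the vector, so the coefficients of repeated
    vectors are first added up. *)
Lemma in_span_pairs S w (r : seq (k * V)) :
  (forall p, p \in r -> S p.2) -> w = \sum_(p <- r) p.1 *: p.2 -> in_span S w.
Proof.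
move=> rS ->; exists (undup (map snd r)), (fun v => \sum_(p <- r | p.2 == v) p.1); split.
  by move=> v; rewrite mem_undup => /mapP[p pr ->]; apply: rS.
under [RHS]eq_bigr => v _ do rewrite scaler_suml.
rewrite (exchange_big_dep predT) //=; apply: eq_big_seq => p pr.
rewrite (eq_bigl (pred1 p.2)); last by move=> v; rewrite /= eq_sym.
rewrite -big_filter (@filter_pred1_uniq _ _ p.2) ?undup_uniq ?mem_undup ?map_f //.
by rewrite big_seq1.
Qed.

Lemma in_span_lin S c v w : in_span S v -> in_span S w -> in_span S (c *: v + w).
Proof.
move=> [s [f [sS ->]]] [t [g [tS ->]]].
apply: (@in_span_pairs _ _ ([seq (c * f u, u) | u <- s] ++ [seq (g u, u) | u <- t])).
  by move=> p; rewrite mem_cat => /orP[] /mapP[u us ->]; [apply: sS | apply: tS].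
rewrite big_cat !big_map scaler_sumr; congr (_ + _).
by apply: eq_bigr => u _; rewrite scalerA.
Qed.

Lemma in_span0 S : in_span S 0.
Proof. by exists [::], (fun=> 0); rewrite big_nil. Qed.

Lemma in_span_mem S v : S v -> in_span S v.
Proof.
move=> Sv; exists [:: v], (fun=> 1); rewrite big_seq1 scale1r.
by split=> // u; rewrite inE => /eqP->.
Qed.

Lemma in_span_ind S (P : V -> Prop) :
  P 0 -> (forall c v w, P v -> P w -> P (c *: v + w)) -> (forall v, S v -> P v) ->
  forall w, in_span S w -> P w.
Proof.
move=> P0 Plin PS w [s [c [sS ->]]]; rewrite big_seq.
by elim/big_rec: _ => // v u vs Pu; apply: Plin => //; apply/PS/sS.
Qed.

Lemma in_span_sum S (I : eqType) (r : seq I) (F : I -> V) :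
  (forall i, i \in r -> S (F i)) -> in_span S (\sum_(i <- r) F i).
Proof.
move=> FS; rewrite big_seq; elim/big_rec: _ => [|i v ir Sv]; first exact: in_span0.
by rewrite -[F i]scale1r; apply/in_span_lin/Sv/in_span_mem/FS.
Qed.

Lemma lin_indep_sub S S' : (forall v, S v -> S' v) -> lin_indep S' -> lin_indep S.
Proof. by move=> SS' indS s c s_uniq sS; apply: indS => // v vs; apply/SS'/sS. Qed.

End Span.

(** * Linear independence of S *)

Section Basis.
Variables (k : fieldType).
Hypothesis char0 : [pchar k] =i pred0.
Local Notation D := (DerPerm k).
Implicit Types (a b : D) (l : seq gen) (u : mon).

Lemma mcoeff_monv u v : mcoeff v (monv k u) = (u == v)%:R.
Proof. by rewrite /monv mcoeffU. Qed.

Lemma mcoeff_sum_scale (I : Type) (r : seq I) (c : I -> k) (F : I -> D) u :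
  mcoeff u (\sum_(i <- r) c i *: F i : D) = \sum_(i <- r) c i * mcoeff u (F i).
Proof.
elim: r => [|i r IHr]; first by rewrite !big_nil mcoeff0.
by rewrite !big_cons mcoeffD mcoeffZ IHr.
Qed.

(* The monomials occurring in [star_seq k l]; each of them determines [l] up to
   permutation ([mcoeff_marker_perm]). *)
Definition marker l (z : gen) : mon := (seq_mset (rem z l), gen' z).

Lemma gen'_inj : injective gen'.
Proof. by move=> [x s] [y t] [-> ->]. Qed.

Lemma mcoeff_star_seq l u : mcoeff u (star_seq k l) = (\sum_(z <- l) (marker l z == u))%:R.
Proof.
rewrite -[star_seq k l]scale1r scaler_sumr mcoeff_sum_scale natr_sum.
by apply: eq_bigr => z _; rewrite mul1r mcoeff_monv.
Qed.

(** The coefficient counts the occurrences of z in [l], a positive integer, which is nonzero in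
    characteristic 0. *)
Lemma mcoeff_marker l z : z \in l -> mcoeff (marker l z) (star_seq k l) != 0.
Proof.
move=> zl; rewrite mcoeff_star_seq ((pcharf0P k).1 char0).
by rewrite (big_rem z) //= eqxx.
Qed.

(** The last factor of a marker reveals the letter that was removed; putting it back recovers the
    word. *)
Lemma mcoeff_marker_perm l l' z :
  z \in l -> mcoeff (marker l z) (star_seq k l') != 0 -> perm_eq l l'.
Proof.
move=> zl; rewrite mcoeff_star_seq ((pcharf0P k).1 char0) sum_nat_seq_neq0.
case/hasP => y yl' /=; rewrite eqb0 negbK => /eqP yz_eq.
have /eq_seq_msetP rem_eq := congr1 fst yz_eq; have /gen'_inj yz := congr1 snd yz_eq.
rewrite -{z yz_eq}yz in zl rem_eq.
rewrite (permPl (perm_to_rem zl)) perm_sym (permPl (perm_to_rem yl')).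
by rewrite perm_cons.
Qed.

Lemma star_seq_inj l l' z : z \in l -> star_seq k l = star_seq k l' -> perm_eq l l'.
Proof.
move=> zl ll'; apply: (mcoeff_marker_perm zl).
by rewrite -ll'; apply: mcoeff_marker.
Qed.

Lemma mweightE u : mweight u = (osum (letters u))%:Z - (size (letters u))%:Z.
Proof.
rewrite /mweight; elim: (letters u) => [|y l IHl]; first by rewrite /osum !big_nil.
by rewrite big_cons IHl osum_cons /=; lia.
Qed.

Lemma mweight_starred u : (mweight u == -2) = ((osum (letters u)).+2 == size (letters u)).
Proof. by rewrite mweightE; lia. Qed.

Lemma S_setP (v : D) : S_set v ->
  (exists i, v = xvar k i) \/
  (exists l, [/\ (0 < size l)%N, (osum l).+2 = size l & v = star_seq k l]).
Proof.
case=> [|[u [/eqP]]]; first by left.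
rewrite mweight_starred star_monv => /eqP ol ->; right; exists (letters u); split=> //.
by rewrite -ol.
Qed.

Lemma S_set_star_seq l : (osum l).+2 = size l -> S_set (star_seq k l).
Proof.
case: l => [|z l] ol; first by rewrite /osum big_nil in ol.
right; exists (word l z).
have ll : perm_eq (letters (word l z)) (z :: l).
  by rewrite /letters perm_rcons perm_cons; apply/eq_seq_msetP/seq_mset_id.
split; last by rewrite star_monv; apply: star_seq_perm; rewrite perm_sym.
by apply/eqP; rewrite mweight_starred; have [-> ->] := perm_shape ll; apply/eqP.
Qed.


Lemma xvar_coef i u : mcoeff u (xvar k i) = ((mset0, (i, 0%N)) == u)%:R.
Proof. exact: mcoeff_monv. Qed.

Lemma xvar_coef0 i j : i != j -> mcoeff (mset0, (j, 0%N)) (xvar k i) = 0.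
Proof.
move=> ij; rewrite xvar_coef (negPf (_ : _ != _)) //.
by apply: contraNneq ij => e; have := congr1 (fun u : mon => u.2.1) e => /= ->.
Qed.

Lemma xvar_marker0 i l z : mcoeff (marker l z) (xvar k i) = 0.
Proof.
rewrite xvar_coef (negPf (_ : _ != _)) //; apply/eqP => e.
by have := congr1 (fun u : mon => u.2.2) e.
Qed.

Lemma star_seq_coef0 i l : mcoeff (mset0, (i, 0%N)) (star_seq k l) = 0.
Proof.
rewrite mcoeff_star_seq big1 // => z _; rewrite (negPf (_ : _ != _)) //; apply/eqP => e.
by have := congr1 (fun u : mon => u.2.2) e.
Qed.

Lemma S_indep : lin_indep (@S_set k).
Proof.
move=> s c s_uniq sS s0 v vs.
(* A monomial u occurring in v and in no other member of [s]: v itself if it is a variable,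
   otherwise a marker. Markers never meet variables, since their last factor has positive order. *)
have [u [uv uw]] : exists u, mcoeff u v != 0 /\
    forall w, w \in s -> w != v -> mcoeff u w = 0.
  have [[i v_i]|[l [l_gt0 _ v_l]]] := S_setP (sS _ vs).
    exists (mset0, (i, 0%N)); split; first by rewrite v_i xvar_coef eqxx oner_neq0.
    move=> w ws; have [[j ->]|[l [_ _ ->]] _] := S_setP (sS _ ws); last exact: star_seq_coef0.
    rewrite v_i => ji; apply: xvar_coef0; apply: contraNneq ji => ->; exact: eqxx.
  have [z zl] : exists z, z \in l.
    by move: l_gt0; rewrite lt0n size_eq0; case: l {v_l} => // z l; exists z; apply: mem_head.
  exists (marker l z); split; first by rewrite v_l; apply: mcoeff_marker.
  move=> w ws; have [[j ->] _|[l' [_ _ ->]]] := S_setP (sS _ ws); first exact: xvar_marker0.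
  rewrite v_l => neq; apply/eqP; apply: contraNT neq => /(mcoeff_marker_perm zl) ll'.
  by apply/eqP/star_seq_perm; rewrite perm_sym.
have := congr1 (mcoeff u) s0; rewrite mcoeff_sum_scale mcoeff0.
rewrite (bigD1_seq v) //= big_seq_cond big1 => [|w /andP[ws wv]]; last by rewrite uw ?mulr0.
by move/eqP; rewrite addr0 mulf_eq0 (negPf uv) orbF => /eqP.
Qed.

Lemma S_sub_ST (v : D) : S_set v -> ST v.
Proof.
case/S_setP => [[i ->]|[l [l_gt0 ol ->]]]; first exact: ST_xvar.
by apply: ST_star_seq; rewrite ?((pcharf0P k).1 char0) -?ol.
Qed.

(** * The weight grading, and S as a spanning set of [ST] *)

Definition weight_mon (w : int) (v : D) : Prop := exists u, mweight u = w /\ v = monv k u.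

Lemma weight_mon_gen y : weight_mon (y.2%:Z - 1) (genv k y).
Proof.
exists (mset0, y); split=> //.
by rewrite /mweight /letters enum_mset0 big_seq1.
Qed.

Lemma letters_mul u v : perm_eq (letters (mon_mul u v)) (letters u ++ letters v).
Proof.
apply/permP => x; have := permP (perm_mon_mul u v) x.
by rewrite /letters -!cats1 !count_cat /= => ->; lia.
Qed.

Lemma mweight_mul u v : mweight (mon_mul u v) = mweight u + mweight v.
Proof. by rewrite /mweight -big_cat; apply/perm_big/letters_mul. Qed.

Lemma in_span_weight_mul i j a b :
  in_span (weight_mon i) a -> in_span (weight_mon j) b -> in_span (weight_mon (i + j)) (a ** b).
Proof.
move=> ai bj; elim/in_span_ind: ai => [|c v w Hv Hw|_ [u [<- ->]]].
- by rewrite pmul0l; apply: in_span0.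
- by rewrite pmulPl; apply: in_span_lin.
elim/in_span_ind: bj => [|c v w Hv Hw|_ [v [<- ->]]].
- by rewrite pmul0r; apply: in_span0.
- by rewrite pmulPr; apply: in_span_lin.
by rewrite pmul_mon; apply: in_span_mem; exists (mon_mul u v); rewrite mweight_mul.
Qed.

Lemma letters_marker l z : perm_eq (letters (marker l z)) (gen' z :: rem z l).
Proof. by rewrite /letters perm_rcons perm_cons; apply/eq_seq_msetP/seq_mset_id. Qed.

Lemma in_span_weight_S (v : D) : S_set v -> in_span (weight_mon (-1)) v.
Proof.
case/S_setP => [[i ->]|[l [_ ol ->]]].
  exact/in_span_mem/(weight_mon_gen (i, 0%N)).
apply: in_span_sum => z zl; exists (marker l z); split=> //.
have [sz oz] := perm_shape (letters_marker l z).
have [sl ol'] := perm_shape (perm_to_rem zl).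
rewrite mweightE sz oz; move: ol; rewrite sl ol' !shapeE (erefl : (gen' z).2 = z.2.+1).
by lia.
Qed.

Lemma in_span_S_star a : in_span (weight_mon (-2)) a -> in_span (@S_set k) (star a).
Proof.
elim/in_span_ind => [|c v w Sv Sw|_ [u [wu ->]]]; first by rewrite star0; apply: in_span0.
  by rewrite starP; apply: in_span_lin.
by apply: in_span_mem; right; exists u.
Qed.

(** A diamond product in [ST] is the star of a product of two elements of weight -1, hence the star
    of a combination of monomials of weight -2. *)
Lemma ST_sub_span a : ST a -> in_span (@S_set k) a.
Proof.
have wS v : in_span (@S_set k) v -> in_span (weight_mon (-1)) v.
  elim/in_span_ind => [|c u w Su Sw|w Sw]; [exact: in_span0 | exact: in_span_lin | ].
  exact: in_span_weight_S.
elim=> [i||c b d _ Sb _ Sd|b d STb Sb STd Sd].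
- by apply: in_span_mem; left; exists i.
- exact: in_span0.
- exact: in_span_lin.
rewrite diamond_ST //; apply: in_span_S_star.
exact: (in_span_weight_mul (wS _ Sb) (wS _ Sd)).
Qed.

Lemma S_basis : is_basis (@S_set k) (@ST k).
Proof. split; [exact: S_sub_ST | exact: S_indep | exact: ST_sub_span]. Qed.

(** * The multilinear component and its dimension *)

Definition multilinear (n : nat) (l : seq gen) : bool := perm_eq [seq y.1 | y <- l] (iota 0 n).

Lemma multilinear_monP n u : multilinear_mon n u <-> multilinear n (letters u).
Proof.
split=> [[su lu]|lu].
  have su' : size [seq y.1 | y <- letters u] = size (iota 0 n) by rewrite size_map size_iota.
  (* A list with the length and the members of a duplicate-free list is itself duplicate-free. *)
  by apply: (uniq_perm _ (iota_uniq 0 n) lu); rewrite (eq_uniq su' lu) iota_uniq.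
split; last exact: perm_mem.
by rewrite /mdegree -(size_map fst) (perm_size lu) size_iota.
Qed.

Lemma perm_multilinear n l l' : perm_eq l l' -> multilinear n l = multilinear n l'.
Proof. by move=> ll'; rewrite /multilinear (permPl (perm_map _ ll')). Qed.

Lemma multilinear_marker n l z : z \in l -> multilinear n (letters (marker l z)) = multilinear n l.
Proof.
move=> zl; rewrite (perm_multilinear n (letters_marker l z)).
by rewrite (perm_multilinear n (perm_to_rem zl)).
Qed.

(** Projection onto the multilinear component. It sends each star of a word to itself or to 0, so a
    combination of S that is multilinear only needs multilinear members of S. *)
Definition mult_proj (n : nat) : D -> D :=
  lext (fun u => if multilinear n (letters u) then monv k u else 0).

Lemma mult_proj_id n a : (forall u, u \in msupp a -> multilinear_mon n u) -> mult_proj n a = a.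
Proof.
move=> an; rewrite /mult_proj lextE [RHS]monalgE big_seq [RHS]big_seq.
apply: eq_bigr => u ua; rewrite (multilinear_monP n u).1; last exact: an.
by apply/malgP => v; rewrite mcoeffZ mcoeff_monv mcoeffU mulr_natr.
Qed.

Lemma mult_proj_star_seq n l :
  mult_proj n (star_seq k l) = if multilinear n l then star_seq k l else 0.
Proof.
rewrite /mult_proj /star_seq (big_morph _ (lextD _) (lext0 _)).
rewrite (eq_big_seq (fun z => if multilinear n l then monv k (marker l z) else 0)) => [|z zl].
  by case: multilinear; rewrite // big1.
by rewrite lext_mon multilinear_marker.
Qed.

Lemma mult_proj_xvar n i : (1 < n)%N -> mult_proj n (xvar k i) = 0.
Proof.
move=> n_gt1; rewrite /mult_proj lext_mon /letters enum_mset0 /multilinear.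
by case: ifP => // /perm_size /=; rewrite size_iota => n1; rewrite -n1 in n_gt1.
Qed.

Lemma STmult_star_seq n l : (osum l).+2 = size l -> multilinear n l -> STmult n (star_seq k l).
Proof.
move=> ol nl; split; first exact/S_sub_ST/S_set_star_seq.
move=> u; rewrite -mcoeff_neq0 mcoeff_star_seq ((pcharf0P k).1 char0) sum_nat_seq_neq0.
case/hasP => z zl /=; rewrite eqb0 negbK => /eqP <-.
by apply/multilinear_monP; rewrite multilinear_marker.
Qed.

(** The multilinear word in which the i-th variable has order t_i. Orders are bounded by [m] to make
    these words a finite type. *)
Definition tuple_word (n m : nat) (t : n.-tuple 'I_m) : seq gen := zip (iota 0 n) (map val t).

Lemma tuple_word_shape n m (t : n.-tuple 'I_m) :
  [/\ size (tuple_word t) = n, map fst (tuple_word t) = iota 0 n &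
      map snd (tuple_word t) = map val t].
Proof.
have st : size (iota 0 n) = size (map val t) by rewrite size_iota size_map size_tuple.
split; [|exact/unzip1_zip/eq_leq|exact/unzip2_zip/eq_leq/esym].
by rewrite size_zip -st size_iota minnn.
Qed.

Lemma osum_tuple_word n m (t : n.-tuple 'I_m) : osum (tuple_word t) = (\sum_(i <- t) i)%N.
Proof.
have [_ _ t2] := tuple_word_shape t.
by rewrite -(big_map val predT id) -t2 big_map.
Qed.

Lemma perm_keys_eq (T1 T2 : eqType) (s s' : seq (T1 * T2)) :
  map fst s = map fst s' -> uniq (map fst s) -> perm_eq s s' -> s = s'.
Proof.
elim: s s' => [|z s IHs] [|z' s'] //= [zz' ss'] /andP[zs s_uniq] p.
have : z \in z' :: s' by rewrite -(perm_mem p) mem_head.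
rewrite inE => /predU1P[z_eq|/(map_f fst)]; last by rewrite -ss' (negPf zs).
by rewrite z_eq in p *; rewrite (IHs s') //; move: p; rewrite perm_cons.
Qed.

Lemma perm_tuple_word_inj n m (t t' : n.-tuple 'I_m) :
  perm_eq (tuple_word t) (tuple_word t') -> t = t'.
Proof.
have [_ t1 t2] := tuple_word_shape t; have [_ t1' t2'] := tuple_word_shape t'.
move=> tt'; suff e : tuple_word t = tuple_word t'.
  by apply/val_inj/(inj_map val_inj); rewrite -t2 e t2'.
by apply: perm_keys_eq tt'; rewrite t1 ?t1' ?iota_uniq.
Qed.

(** The letters are sorted by variable; each order is at most the order sum, so it fits into
    ['I_m.+1]. *)
Lemma multilinear_tuple_word n m l : (osum l <= m)%N -> multilinear n l ->
  exists t : n.-tuple 'I_m.+1, perm_eq l (tuple_word t).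
Proof.
move=> ol nl; pose l' := sort (relpre fst leq) l.
have ll' : perm_eq l' l by rewrite perm_sort.
have l'1 : map fst l' = iota 0 n.
  rewrite /l' -sort_map; have /(perm_sortP leq_total leq_trans anti_leq) -> := nl.
  by rewrite sorted_sort ?iota_sorted //; apply: leq_trans.
have sl' : size (map snd l') == n by rewrite size_map -(size_map fst) l'1 size_iota.
have le_m s : s \in map snd l' -> (s <= m)%N.
  case/mapP => y; rewrite (perm_mem ll') => yl ->; apply: leq_trans ol.
  by rewrite /osum (big_rem y) //= leq_addr.
have si : size (map (@inord m) (map snd l')) == n by rewrite size_map.
exists (Tuple si); rewrite perm_sym (_ : tuple_word _ = l') // /tuple_word /=.
rewrite -l'1 -[in RHS](zip_unzip l') -map_comp; congr zip.
rewrite map_id_in // => s /le_m s_le /=; exact: inordK.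
Qed.

(** With n = m + 2, the multilinear members of S correspond to the m + 2 orders with sum m, which
    [card_ord_partitions] counts. *)
Lemma STmult_dim m : has_dim (@STmult k m.+2) 'C(m.+1 + m, m.+1).
Proof.
pose A := [set t : m.+2.-tuple 'I_m.+1 | \sum_(i <- t) i == m]%N.
pose w (t : m.+2.-tuple 'I_m.+1) := star_seq k (tuple_word t).
have size_tw (t : m.+2.-tuple 'I_m.+1) : size (tuple_word t) = m.+2.
  by have [-> _ _] := tuple_word_shape t.
have wA t : t \in A -> (osum (tuple_word t)).+2 = size (tuple_word t).
  by rewrite inE => /eqP ot; rewrite osum_tuple_word ot size_tw.
have sA v : v \in [seq w t | t <- enum A] -> S_set v /\ STmult m.+2 v.
  case/mapP => t; rewrite mem_enum => /wA ot ->; split; first exact: S_set_star_seq.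
  apply: STmult_star_seq => //; rewrite /multilinear.
  by have [_ -> _] := tuple_word_shape t.
have w_inj : injective w.
  move=> t t'; have [z zt] : exists z, z \in tuple_word t.
    have := size_tw t; case: (tuple_word t) => // z l _.
    by exists z; apply: mem_head.
  by move/(star_seq_inj zt); apply: perm_tuple_word_inj.
exists [seq w t | t <- enum A]; split.
- by rewrite map_inj_uniq // enum_uniq.
- by rewrite size_map -cardE card_ord_partitions.
split.
- by move=> v /sA[].
- by apply: lin_indep_sub S_indep => v /sA[].
move=> a [/ST_sub_span Sa an]; rewrite -(mult_proj_id an).
elim/in_span_ind: Sa {an} => [|c v v' Sv Sv'|v].
- by rewrite /mult_proj lext0; apply: in_span0.
- by rewrite /mult_proj lextP; apply: in_span_lin.
case/S_setP => [[i ->]|[l [_ ol ->]]]; first by rewrite mult_proj_xvar //; apply: in_span0.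
rewrite mult_proj_star_seq; case: ifP => [nl|_]; last exact: in_span0.
have sl : size l = m.+2 by rewrite -(size_map fst) (perm_size nl) size_iota.
have [|t lt] := @multilinear_tuple_word m.+2 m l _ nl; first by move: ol; rewrite sl => -[->].
apply/in_span_mem/mapP; exists t; last exact: star_seq_perm.
have [st ot] := perm_shape lt; rewrite mem_enum inE -osum_tuple_word -ot.
by move: ol; rewrite sl => -[->].
Qed.

End Basis.

Theorem corollary4p6 (k : fieldType) (char0 : [pchar k] =i pred0) :
  is_basis (@S_set k) (@ST k) /\
  forall n : nat, (2 <= n)%N -> has_dim (@STmult k n) 'C(2 * n - 3, n - 1)%N.
Proof.
split=> [|n n_ge2]; first exact: S_basis.
have -> : n = (n - 2).+2 by lia.
move: (n - 2)%N => m; rewrite (_ : 2 * m.+2 - 3 = m.+1 + m)%N ?subn1; last by lia.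
exact: STmult_dim.
Qed.
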